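(* For any ordered set $\mathbf{Y}$, \[ \beta_{\leqslant}(\mathbf{Y})=b(\mathbf{Y})=b_0(\mathbf{Y})=n_{\mathcal{P}}(\mathbf{Y}), \] where $\beta_{\leqslant}(\mathbf{Y})$ is the Nachbin order-compactification of $\mathbf{Y}$, $b(\mathbf{Y})$ and $b_0(\mathbf{Y})$ are its Bohr and zero-dimensional Bohr compactifications, and $n_{\mathcal{P}}(\mathbf{Y})$ is its natural extension in the category $\mathcal{P}$ of ordered sets.
   Context: An ordered set is a partially ordered set; $\mathcal{P}=\mathsf{IS}^0\mathsf{P}(\mathbb{2})$ is the category of ordered sets and order-preserving maps, where $\mathbb{2}=\langle\{0,1\};\leqslant\rangle$ is the two-element chain with $0<1$. $\mathbb{2}_{\mathscr{T}}$ is $\mathbb{2}$ with the discrete topology. $\mathcal{P}_{\mathscr{T}}=\mathsf{IS}^0_{\mathrm c}\mathsf{P}(\mathbb{2}_{\mathscr{T}})$, the class of isomorphic copies of (possibly empty) topologically closed substructures of powers of $\mathbb{2}_{\mathscr{T}}$, is the category of Priestley spaces (with continuous order-preserving maps). All compact spaces are assumed Hausdorff. A compact ordered space is an ordered set with a compact topology in which $\leqslant$ is closed in $Y\times Y$. $\mathcal{P}^{\mathrm{ct}}$ is the category of compact ordered spaces and continuous order-preserving maps; $\mathcal{P}^{\mathrm{Bt}}$ is its full subcategory of those with zero-dimensional topology (having a basis of clopen sets). $^\flat$ forgets the topology. The Nachbin order-compactification $\beta_{\leqslant}(\mathbf{Y})$ is the reflection of $\mathbf{Y}$ (discretely topologised)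 into the category of compact ordered spaces. The Bohr compactification $b(\mathbf{Y})\in\mathcal{P}^{\mathrm{ct}}$ comes with an order-embedding $\iota_{\mathbf{Y}}\colon\mathbf{Y}\to b(\mathbf{Y})^\flat$ with dense image and is characterised up to isomorphism by: for every $\mathbf{Z}\in\mathcal{P}^{\mathrm{ct}}$ and order-preserving $g\colon\mathbf{Y}\to\mathbf{Z}^\flat$ there is a unique continuous order-preserving map $h\colon b(\mathbf{Y})\to\mathbf{Z}$ with $h\circ\iota_{\mathbf{Y}}=g$. $b_0(\mathbf{Y})\in\mathcal{P}^{\mathrm{Bt}}$ is defined in the same way with $\mathcal{P}^{\mathrm{Bt}}$ in place of $\mathcal{P}^{\mathrm{ct}}$. The natural extension $n_{\mathcal{P}}(\mathbf{Y})\in\mathcal{P}_{\mathscr{T}}$ is the topological closure in $\mathbb{2}_{\mathscr{T}}^{\mathcal{P}(\mathbf{Y},\mathbb{2})}$ of the image of the evaluation map $e_{\mathbf{Y}}(y)(x):=x(y)$, where $\mathcal{P}(\mathbf{Y},\mathbb{2})$ is the set of order-preserving maps $\mathbf{Y}\to\mathbb{2}$. Equality means isomorphism (order-homeomorphism) commuting with the canonical maps from $\mathbf{Y}$. *)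

(* Defs.v *)
From HB Require Import structures.
From mathcomp Require Import all_boot all_order.
From mathcomp Require Import all_classical topology.
Set Implicit Arguments.
Unset Strict Implicit.
Unset Printing Implicit Defensive.
Import Order.TTheory.
Local Open Scope classical_set_scope.
Local Open Scope order_scope.

(* The library has this structure (a partial order and a topology on the same
   carrier, with no compatibility required) but no short name for it. *)
Notation porderTopologicalType := POrderedTopological.type.

HB.instance Definition _ d (Y : porderType d) :=
  Order.POrder.copy (discrete_topology Y) Y.

Definition compact_ordered d (Z : porderTopologicalType d) : Prop :=
  [/\ compact [set: Z], hausdorff_space Z
    & closed [set p : Z * Z | p.1 <= p.2]].

(* The library's [zero_dimensional] only says that distinct points are
   separated by clopen sets, hence the explicit basis. *)
Definition boolean_ordered d (Z : porderTopologicalType d) : Prop :=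
  compact_ordered Z /\ basis [set U : set Z | clopen U].

Definition cts_order_preserving d (X : porderTopologicalType d)
    d' (Z : porderTopologicalType d') (f : X -> Z) : Prop :=
  continuous f /\ {homo f : x y / x <= y}.

(* [eta] is the unit of a reflection of the ordered space [X] into the category
   of compact ordered spaces. *)
Definition nachbin_compactification d (X : porderTopologicalType d)
    dB (B : porderTopologicalType dB) (eta : X -> B) : Prop :=
  [/\ compact_ordered B,
      cts_order_preserving eta
    & forall dZ (Z : porderTopologicalType dZ) (g : X -> Z),
        compact_ordered Z -> cts_order_preserving g ->
        exists! h : B -> Z, cts_order_preserving h /\ h \o eta = g].

(* [K] is the class of objects of a full subcategory of compact ordered spaces. *)
Definition bohr_compactification_in
    (K : forall d, porderTopologicalType d -> Prop)
    d (Y : porderType d) dB (B : porderTopologicalType dB)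
    (iota : Y -> B) : Prop :=
  [/\ K dB B,
      {mono iota : x y / x <= y},
      dense (range iota)
    & forall dZ (Z : porderTopologicalType dZ) (g : Y -> Z),
        K dZ Z -> {homo g : x y / x <= y} ->
        exists! h : B -> Z, cts_order_preserving h /\ h \o iota = g].

Definition bohr_compactification d (Y : porderType d)
    dB (B : porderTopologicalType dB) (iota : Y -> B) : Prop :=
  bohr_compactification_in (@compact_ordered) iota.

Definition zero_dim_bohr_compactification d (Y : porderType d)
    dB (B : porderTopologicalType dB) (iota : Y -> B) : Prop :=
  bohr_compactification_in (@boolean_ordered) iota.

Definition two_power (I : Type) : Type := {ptws I -> bool}.

HB.instance Definition _ (I : Type) :=
  Topological.copy (two_power I) {ptws I -> bool}.
HB.instance Definition _ (I : Type) :=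
  Order.POrder.copy (two_power I) (I -> bool).

Definition evaluation d (Y : porderType d) (y : Y) :
    two_power {omorphism Y -> bool} :=
  fun x => x y.

Definition natural_extension d (Y : porderType d) : Type :=
  set_type (closure (range (@evaluation d Y))).

HB.instance Definition _ d (Y : porderType d) :=
  SubChoice.on (natural_extension Y).
HB.instance Definition _ d (Y : porderType d) :=
  Topological.copy (natural_extension Y)
    (set_type (closure (range (@evaluation d Y)))).
HB.instance Definition _ d (Y : porderType d) :=
  [SubChoice_isSubPOrder of natural_extension Y by <:
     with FunOrder.fun_display].

Definition natural_extension_map d (Y : porderType d) (y : Y) :
    natural_extension Y :=
  SigSub (mem_set (subset_closure (imageT (@evaluation d Y) y))).

(* Equality of two compactifications of the same [Y]: an order-homeomorphism
   commuting with the canonical maps. *)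
Definition same_compactification (Y : Type)
    dA (A : porderTopologicalType dA) dB (B : porderTopologicalType dB)
    (a : Y -> A) (b : Y -> B) : Prop :=
  exists (f : A -> B) (g : B -> A),
    [/\ cancel f g, cancel g f, cts_order_preserving f,
        cts_order_preserving g & f \o a = b].

(* Main.v *)
(** Everything reduces to showing that the natural extension is already
universal for all compact ordered spaces. Let [g : Y -> Z] be order-preserving
with [Z] compact ordered, and let [p <= q] in the natural extension. If [a]
and [b] are cluster values of [g] along the traces on [Y] of the neighbourhoods
of [p] and of [q], then [a <= b]: otherwise, as the order of [Z] is closed,
there are neighbourhoods [O] of [a] and [V] of [b] with no [o <= v], and the
indicator of the up-set generated by [g @^-1` O] is a coordinate with value
[true] at [p] and [false] at [q]. Taking [p = q], cluster values are unique,
so [g] extends by limits, and the same inequality makes the extension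
order-preserving. *)
From HB Require Import structures.
Require Import Defs.
From mathcomp Require Import all_boot all_order.
From mathcomp Require Import all_classical topology.
Set Implicit Arguments.
Unset Strict Implicit.
Unset Printing Implicit Defensive.
Import Order.TTheory.
Local Open Scope classical_set_scope.
Local Open Scope order_scope.

Lemma le_bool_implE (a b : bool) : (a <= b) = (a ==> b).
Proof. by case: a; case: b. Qed.

(** * The natural extension as a zero-dimensional compact ordered space *)

Section NaturalExtension.
Context {d : Order.disp_t} {Y : porderType d}.

Local Notation N := (natural_extension Y).
Local Notation e := (@natural_extension_map d Y).

Definition coordinate (x : {omorphism Y -> bool}) (p : N) : bool := \val p x.

Lemma coordinateE x y : coordinate x (e y) = x y.
Proof. by []. Qed.

Lemma le_natural_extensionP (p q : N) :
  reflect (forall x, coordinate x p <= coordinate x q) (p <= q).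
Proof. exact: asboolP. Qed.

Lemma coordinate_continuous x : continuous (coordinate x).
Proof.
move=> p; apply: (@continuous_comp N (two_power _) bool \val
  (fun f => f x)); first exact: initial_continuous.
exact: (@proj_continuous {classic {omorphism Y -> bool}} (fun=> bool) x).
Qed.

Lemma clopen_coordinate x b : clopen [set p | coordinate x p = b].
Proof.
apply: (@preimage_clopen _ _ (coordinate x) [set b]).
  by split; [exact: discrete_open|exact: discrete_closed].
exact: coordinate_continuous.
Qed.

(** A continuous map into the discrete space [bool] is locally constant. *)
Lemma nbhs_coordinate x p : \forall q \near p, coordinate x q = coordinate x p.
Proof.
by apply: open_nbhs_nbhs; split => //; have [] := clopen_coordinate x (coordinate x p).
Qed.

Lemma coordinate_separates (p q : N) :
  p != q -> exists x, coordinate x p != coordinate x q.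
Proof.
apply: contra_neqP => /forallNP pq; apply/val_inj/funext => x.
by apply/eqP/negPn/negP; exact: pq.
Qed.

Lemma natural_extension_compact : compact [set: N].
Proof.
have tyc : compact [set: two_power {omorphism Y -> bool}].
  have := @tychonoff {classic {omorphism Y -> bool}} (fun=> bool) (fun=> setT)
    (fun=> bool_compact).
  by congr compact; apply/seteqP; split.
have cK : compact (closure (range (@evaluation d Y))).
  by apply: subclosed_compact tyc _ => //; exact: closed_closure.
(* A proper filter on the subspace is pushed into the power; its cluster point there lies in the
   closure and is pulled back. *)
pose v (p : N) : two_power _ := \val p.
move=> F FF _; have [|f [Kf clf]] := cK (v @ F) _.
  rewrite nbhs_filterE; apply: (@filterS _ F _ [set: N]); last exact: filterT.
  by move=> p _; exact: set_mem (valP p).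
exists (SigSub (mem_set Kf)); split=> // A V FA [_ [[W oW <-] Wf] WV].
have [|_ [[p Ap <-] Wp]] := clf (v @` A) W _ (open_nbhs_nbhs (conj oW Wf)).
  by rewrite nbhs_filterE; apply: (@filterS _ F _ A) => // p Ap; exists p.
by exists p; split => //; exact: WV.
Qed.

Lemma natural_extension_hausdorff : hausdorff_space N.
Proof.
rewrite open_hausdorff => p q /coordinate_separates[x pq].
exists ([set r | coordinate x r = coordinate x p],
        [set r | coordinate x r = coordinate x q]); rewrite ?inE//=; split.
- by have [] := clopen_coordinate x (coordinate x p).
- by have [] := clopen_coordinate x (coordinate x q).
- apply/seteqP; split=> // r [].
  by rewrite /mkset => rp rq; move: pq; rewrite -rp rq eqxx.
Qed.

(** The order is coordinatewise and coordinates are locally constant, so near a limit pair there is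
    a comparable pair with the same values at the given [x]. *)
Lemma natural_extension_closed_le : closed [set p : N * N | p.1 <= p.2].
Proof.
move=> [p q] clpq /=; apply/le_natural_extensionP => x.
have [|[p' q'] [/= /le_natural_extensionP/(_ x) + [pp' qq']]] := clpq
  ([set r | coordinate x r = coordinate x p] `*`
   [set r | coordinate x r = coordinate x q]).
  exists ([set r | coordinate x r = coordinate x p],
          [set r | coordinate x r = coordinate x q]) => //.
  by split; exact: nbhs_coordinate.
by rewrite pp' qq'.
Qed.

Lemma natural_extension_compact_ordered : compact_ordered N.
Proof.
split; [exact: natural_extension_compact|exact: natural_extension_hausdorff|].
exact: natural_extension_closed_le.
Qed.

(** In a compact Hausdorff space, separating points by clopen sets is enough for the clopen
    neighbourhoods of each point to form a local base. *)
Lemma natural_extension_boolean_ordered : boolean_ordered N.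
Proof.
split; first exact: natural_extension_compact_ordered.
split=> [U []//|p].
have -> : [set U | [set U : set N | clopen U] U /\ U p] =
    [set U | U p /\ clopen U] by apply/seteqP; split=> U [].
apply: zero_dimensional_cvg.
- exact: natural_extension_hausdorff.
- move=> q r /coordinate_separates[x qr].
  exists [set s | coordinate x s = coordinate x q]; split => //.
    exact: clopen_coordinate.
  by move=> /esym/eqP; rewrite (negbTE qr).
- exact: natural_extension_compact.
Qed.

(** * Density and order-embedding of the canonical map *)

Lemma natural_extension_map_dense : dense (range e).
Proof.
move=> O [p Op] [W oW WO]; move: Op; rewrite -WO => Wp.
have [_ [[y _ <-] Wy]] := set_mem (valP p) W (open_nbhs_nbhs (conj oW Wp)).
by exists (e y); split => //; exists y.
Qed.

Lemma nbhs_natural_extension_map (p : N) (W : set N) :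
  nbhs p W -> exists y, W (e y).
Proof.
rewrite nbhsE => -[O [oO Op] OW].
have [|q [/OW + [y _ yq]]] := natural_extension_map_dense _ oO.
  by exists p.
by rewrite -yq => Wy; exists y.
Qed.

(** These are the only coordinates the argument evaluates: principal up-sets show that the canonical
    map reflects the order, and up-sets generated by preimages of open sets separate cluster
    values. *)
Definition upset_indicator (U : set Y) (y : Y) : bool :=
  `[< exists2 u, U u & u <= y >].

Lemma upset_indicator_homo U : {homo upset_indicator U : x y / x <= y}.
Proof.
move=> x y xy; rewrite le_bool_implE; apply/implyP => /asboolP[u Uu ux].
by apply/asboolP; exists u => //; exact: le_trans xy.
Qed.

HB.instance Definition _ U :=
  Order.isOrderMorphism.Build d Y _ bool (upset_indicator U)
    (@upset_indicator_homo U).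

Lemma natural_extension_map_mono : {mono e : x y / x <= y}.
Proof.
move=> x y; apply/idP/idP => [/le_natural_extensionP|xy].
  move=> /(_ (upset_indicator [set x])); rewrite !coordinateE le_bool_implE.
  have xx : upset_indicator [set x] x by apply/asboolP; exists x.
  by move=> /implyP/(_ xx)/asboolP[_ ->].
by apply/le_natural_extensionP => f; rewrite !coordinateE; exact: omorph_le.
Qed.

(** * Extending order-preserving maps by limits *)

Section Extension.
Context {dZ : Order.disp_t} {Z : porderTopologicalType dZ} {g : Y -> Z}.
Context (coZ : compact_ordered Z) (g_homo : {homo g : x y / x <= y}).

(** The image under [g] of the trace on [Y] of the neighbourhood filter of [p]; density of the
    canonical map makes it proper. *)
Definition trace_filter (p : N) : set_system Z :=
  filter_from (nbhs p) (fun W => g @` (e @^-1` W)).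

Lemma trace_filter_proper p : ProperFilter (trace_filter p).
Proof.
apply: filter_from_proper.
  apply: filter_from_filter; first by exists setT; exact: filterT.
  move=> W W' pW pW'; exists (W `&` W'); first exact: filterI.
  by move=> _ [y [Wy Wy'] <-]; split; exists y.
by move=> W /nbhs_natural_extension_map[y Wy]; exists (g y), y.
Qed.
#[local] Existing Instance trace_filter_proper.

Lemma cluster_trace_filter p z : cluster (trace_filter p) z <->
  forall W V, nbhs p W -> nbhs z V -> exists y, W (e y) /\ V (g y).
Proof.
split=> [clz W V pW zV|H A V [W pW WA] /(H _ _ pW)[y [Wy Vy]]]; last first.
  by exists (g y); split => //; apply: WA; exists y.
have [|_ [[y Wy <-] Vy]] := clz (g @` (e @^-1` W)) V _ zV; first by exists W.
by exists y.
Qed.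

Lemma cluster_trace_filter_le p q a b : p <= q ->
  cluster (trace_filter p) a -> cluster (trace_filter q) b -> a <= b.
Proof.
move=> pq /cluster_trace_filter cla /cluster_trace_filter clb.
have [_ _ leZ] := coZ; apply/negP => /negP nab.
have : nbhs (a, b) (~` [set r : Z * Z | r.1 <= r.2]).
  apply: open_nbhs_nbhs; split; first exact: closed_openC.
  exact/negP.
move=> [[O V] [/= aO bV] OV].
pose x : {omorphism Y -> bool} := upset_indicator (g @^-1` O).
have [y [yp Oy]] := cla _ _ (nbhs_coordinate x p) aO.
have [z [zq Vz]] := clb _ _ (nbhs_coordinate x q) bV.
have xpq : coordinate x p <= coordinate x q by move/le_natural_extensionP: pq.
move: xpq; rewrite -yp -zq !coordinateE le_bool_implE => /implyP xyz.
have /xyz/asboolP[u Ou uz] : x y by apply/asboolP; exists y.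
(* Here [g u] lies in [O] and [g z] in [V], while [u <= z] forces [g u <= g z], against the choice
   of [O] and [V]. *)
by apply: (OV (g u, g z)) => //=; exact: g_homo.
Qed.

(** Compactness gives a cluster point, antisymmetry makes it unique, and in a compact Hausdorff
    space a filter with a single cluster point converges to it. *)
Lemma trace_filter_cvg p : exists z : Z,
  cluster (trace_filter p) z /\ trace_filter p --> z.
Proof.
have [cZ hZ _] := coZ.
have [|z [_ clz]] := cZ (trace_filter p) _; first exact: filterT.
exists z; split=> //; apply: (@compact_cluster_set1 _ z _ setT) => //; try exact: filterT.
apply/seteqP; split=> [a cla|_ ->//].
by apply/le_anti/andP; split; exact: (cluster_trace_filter_le (lexx p)).
Qed.

Lemma natural_extension_lift :
  exists! h : N -> Z, cts_order_preserving h /\ h \o e = g.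
Proof.
have [cZ hZ _] := coZ.
have [h h_lim] := choice trace_filter_cvg.
have hcl p := (h_lim p).1.
have hE p z : cluster (trace_filter p) z -> h p = z.
  move=> clz.
  by apply/le_anti/andP; split; apply: (cluster_trace_filter_le (lexx p)).
exists h; split=> [|h' [[h'c h'_homo] h'e]]; last first.
  (* By continuity, any competing extension [h'] takes at [p] a cluster value of the trace filter,
     and there is only one. *)
  apply/funext => p; apply/hE/cluster_trace_filter => W V pW hV.
  have [y [Wy Vy]] := nbhs_natural_extension_map (filterI pW (h'c _ _ hV)).
  by exists y; rewrite -h'e.
split; last first.
  apply/funext => y; apply/hE/cluster_trace_filter => W V pW zV.
  by exists y; split; exact: nbhs_singleton.
split=> [p G hG|p q pq]; last exact: cluster_trace_filter_le pq _ _.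
(* Continuity by regularity: [C] is a neighbourhood of [h p] with closure inside [G]. If [g] sends
   the trace of [W] into [C], then for each [q] interior to [W] the cluster value [h q] lies in the
   closure of [C]. *)
have [C hC CG] := compact_regular hZ cZ (@filterT _ _ (nbhs_filter (h p))) hG.
have [W pW WC] := (h_lim p).2 C hC.
have := nbhs_interior pW; apply: filterS => q qW; apply: CG => V hV.
have [y [Wy Vy]] := (cluster_trace_filter _ _).1 (hcl q) _ _ qW hV.
by exists (g y); split => //; apply: WC; exists y.
Qed.

End Extension.
End NaturalExtension.

(** * Uniqueness of universal objects *)

Definition universal_in (K : forall d, porderTopologicalType d -> Prop)
    d (Y : porderType d) dB (B : porderTopologicalType dB) (b : Y -> B) : Prop :=
  [/\ K dB B, {homo b : x y / x <= y}
    & forall dZ (Z : porderTopologicalType dZ) (g : Y -> Z),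
        K dZ Z -> {homo g : x y / x <= y} ->
        exists! h : B -> Z, cts_order_preserving h /\ h \o b = g].

Lemma cts_order_preserving_id d (X : porderTopologicalType d) :
  cts_order_preserving (@id X).
Proof. by split=> // x; exact: cvg_id. Qed.

Lemma cts_order_preserving_comp d1 (X1 : porderTopologicalType d1)
    d2 (X2 : porderTopologicalType d2) d3 (X3 : porderTopologicalType d3)
    (f : X1 -> X2) (g : X2 -> X3) :
  cts_order_preserving f -> cts_order_preserving g ->
  cts_order_preserving (g \o f).
Proof.
move=> [fc fo] [gc go]; split=> [x|x y xy]; last exact/go/fo.
by apply: continuous_comp; [exact: fc|exact: gc].
Qed.

Section Universal.
Context (K : forall d, porderTopologicalType d -> Prop).
Context (d : Order.disp_t) (Y : porderType d).

(** Both [h] and the identity extend [b] along itself. *)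
Lemma universal_in_endo dB (B : porderTopologicalType dB) (b : Y -> B)
    (h : B -> B) :
  universal_in K b -> cts_order_preserving h -> h \o b = b -> h =1 id.
Proof.
move=> [KB bo bU] hc hb x; have [k [_ kU]] := bU _ _ _ KB bo.
rewrite -(kU h)// (kU id)//; split=> //; exact: cts_order_preserving_id.
Qed.

Lemma universal_in_same dA (A : porderTopologicalType dA) (a : Y -> A)
    dB (B : porderTopologicalType dB) (b : Y -> B) :
  universal_in K a -> universal_in K b -> same_compactification a b.
Proof.
move=> aU bU; have [KA ao aE] := aU; have [KB bo bE] := bU.
have [f [[fc fa] _]] := aE _ _ _ KB bo.
have [g [[gc gb] _]] := bE _ _ _ KA ao.
exists f, g; split => //.
- apply: (universal_in_endo aU (cts_order_preserving_comp fc gc)).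
  by rewrite -compA fa.
- apply: (universal_in_endo bU (cts_order_preserving_comp gc fc)).
  by rewrite -compA gb.
Qed.

End Universal.

Lemma same_compactification_sym (Y : Type) dA (A : porderTopologicalType dA)
    dB (B : porderTopologicalType dB) (a : Y -> A) (b : Y -> B) :
  same_compactification a b -> same_compactification b a.
Proof.
move=> [f [g [fK gK fc gc fa]]]; exists g, f; split => //.
by rewrite -fa; apply/funext => y /=.
Qed.

Lemma same_compactification_trans (Y : Type) dA (A : porderTopologicalType dA)
    dB (B : porderTopologicalType dB) dC (C : porderTopologicalType dC)
    (a : Y -> A) (b : Y -> B) (c : Y -> C) :
  same_compactification a b -> same_compactification b c ->
  same_compactification a c.
Proof.
move=> [f [g [fK gK fc gc fa]]] [f' [g' [fK' gK' fc' gc' fa']]].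
exists (f' \o f), (g \o g'); split.
- exact: can_comp.
- exact: can_comp.
- exact: cts_order_preserving_comp.
- exact: cts_order_preserving_comp.
- by rewrite -compA fa.
Qed.

(** * Comparison of the compactifications *)

Lemma bohr_compactification_in_universal K d (Y : porderType d)
    dB (B : porderTopologicalType dB) (b : Y -> B) :
  bohr_compactification_in K b -> universal_in K b.
Proof. by move=> [KB b_mono _ bU]; split => // x y; rewrite b_mono. Qed.

Lemma discrete_cts_order_preserving d (Y : porderType d)
    dZ (Z : porderTopologicalType dZ) (g : discrete_topology Y -> Z) :
  {homo g : x y / x <= y} -> cts_order_preserving g.
Proof.
by move=> go; split=> //; apply/continuousP => A _; exact: discrete_open.
Qed.

(** Maps out of a discrete space are continuous, so the reflection property tests exactly the
    order-preserving maps, as the Bohr property does. *)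
Lemma nachbin_compactification_universal d (Y : porderType d)
    dB (B : porderTopologicalType dB) (b : discrete_topology Y -> B) :
  nachbin_compactification b <-> universal_in (@compact_ordered) (b : Y -> B).
Proof.
split=> [[cB [_ bo] bU]|[cB bo bU]]; split=> //.
- by move=> dZ Z g cZ go; apply: bU => //; exact: discrete_cts_order_preserving.
- exact: discrete_cts_order_preserving.
- by move=> dZ Z g cZ [_]; exact: bU.
Qed.

(** Extension into all compact ordered spaces restricts to any smaller class, so one statement
    serves both Bohr compactifications. *)
Lemma natural_extension_bohr d (Y : porderType d)
    (K : forall d, porderTopologicalType d -> Prop) :
  K _ (natural_extension Y) ->
  (forall d (Z : porderTopologicalType d), K d Z -> compact_ordered Z) ->
  bohr_compactification_in K (@natural_extension_map d Y).
Proof.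
move=> KN Kco; split => //.
- exact: natural_extension_map_mono.
- exact: natural_extension_map_dense.
- by move=> dZ Z g /Kco coZ; exact: natural_extension_lift.
Qed.

Theorem proposition6p4 (d : Order.disp_t) (Y : porderType d) :
  [/\ exists (dB : Order.disp_t) (B : porderTopologicalType dB)
          (eta : discrete_topology Y -> B), nachbin_compactification eta,
      exists (dB : Order.disp_t) (B : porderTopologicalType dB)
          (iota : Y -> B), bohr_compactification iota,
      exists (dB : Order.disp_t) (B : porderTopologicalType dB)
          (iota : Y -> B), zero_dim_bohr_compactification iota
    & forall (d1 : Order.disp_t) (B1 : porderTopologicalType d1)
          (eta : discrete_topology Y -> B1)
          (d2 : Order.disp_t) (B2 : porderTopologicalType d2) (iota : Y -> B2)
          (d3 : Order.disp_t) (B3 : porderTopologicalType d3) (iota0 : Y -> B3),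
        nachbin_compactification eta ->
        bohr_compactification iota ->
        zero_dim_bohr_compactification iota0 ->
        [/\ same_compactification (eta : Y -> B1) iota,
            same_compactification iota iota0
          & same_compactification iota0 (@natural_extension_map d Y)]].
Proof.
have bN : bohr_compactification (@natural_extension_map d Y).
  by apply: natural_extension_bohr => //; exact: natural_extension_compact_ordered.
have b0N : zero_dim_bohr_compactification (@natural_extension_map d Y).
  apply: natural_extension_bohr => [|? ? []//].
  exact: natural_extension_boolean_ordered.
have uN := bohr_compactification_in_universal bN.
have u0N := bohr_compactification_in_universal b0N.
split.
- by exists _, (natural_extension Y), (@natural_extension_map d Y);
    exact/nachbin_compactification_universal.
- by exists _, (natural_extension Y), (@natural_extension_map d Y).
- by exists _, (natural_extension Y), (@natural_extension_map d Y).
move=> d1 B1 eta d2 B2 iota d3 B3 iota0 /nachbin_compactification_universal u1.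
move=> /bohr_compactification_in_universal u2.
move=> /bohr_compactification_in_universal u3.
(* The universal property of [iota0] tests only zero-dimensional targets, so [iota] and [iota0] are
   compared through the natural extension, which is universal in both classes. *)
have s3 := universal_in_same u3 u0N.
split => //; first exact: universal_in_same u1 u2.
apply: same_compactification_trans (universal_in_same u2 uN) _.
exact: same_compactification_sym.
Qed.
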